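(* Let $V$ be a smooth vector field on $\mathbb{M}^n(C)$. Then $V$ is concircular if and only if $V$ is the tangential part (to $\mathbb{M}^n(C)$) of a constant vector field $p_0$ of $\mathbb{R}^{n+1}_\nu$. Moreover, if $V$ is concircular with concircular factor $\mu$ and $p_0$ is the corresponding constant vector, then $V=p_0+\mu\phi$, where $\mu=-C\langle p_0,\phi\rangle$.
   Context: Let $C\neq 0$ be real, $n\ge 2$, and write $C=\varepsilon/R^2$ with $R>0$, $\varepsilon=(-1)^\nu$, $\nu\in\{0,1\}$ (so $\nu=0$ if $C>0$ and $\nu=1$ if $C<0$). $\mathbb{R}^{n+1}_\nu$ is $\mathbb{R}^{n+1}$ with the flat metric $\langle\,,\rangle=\varepsilon\,dx_1^2+dx_2^2+\cdots+dx_{n+1}^2$. $\mathbb{M}^n(C)=\{p\in\mathbb{R}^{n+1}_\nu:\langle p,p\rangle=1/C\}$, where for $C<0$ one takes the sheet $x_1>0$; with the induced metric it is the sphere ($C>0$) or hyperbolic space ($C<0$) of constant curvature $C$. $\phi:\mathbb{M}^n(C)\to\mathbb{R}^{n+1}_\nu$ is the inclusion (position vector), and $\overline\nabla$ is the Levi-Civita connection of $\mathbb{M}^n(C)$. A vector field $V$ on $\mathbb{M}^n(C)$ is concircular if there is a smooth function $\mu$ on $\mathbb{M}^n(C)$, called the concircular factor, such that $\overline\nabla_XV=\mu X$ for all tangent vector fields $X$. *)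

(* Defs.v *)
From mathcomp Require Export all_boot all_order all_algebra.
From mathcomp Require Export all_classical all_reals all_analysis.

Set Implicit Arguments.
Unset Strict Implicit.
Unset Printing Implicit Defensive.

Import Order.TTheory GRing.Theory Num.Theory.
Export numFieldNormedType.Exports.

Local Open Scope classical_set_scope.
Local Open Scope ring_scope.

(* C^k and C^oo maps on an open set [U]; ['D_v f] is a total operator, and at a
   point of the open set [U] it depends only on the germ of [f] there. *)
Fixpoint Ck_on (R : realType) (E W : normedModType R) (k : nat) (U : set E)
    (f : E -> W) : Prop :=
  match k with
  | 0 => forall x, U x -> {for x, continuous f}
  | k'.+1 => (forall x, U x -> differentiable f x) /\
             (forall v : E, Ck_on k' U (fun x => 'D_v f x))
  end.

Definition smooth_on (R : realType) (E W : normedModType R) (U : set E)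
    (f : E -> W) : Prop := forall k, Ck_on k U f.

(* The flat metric of R^{n+1}_nu, with nu = 1 if C < 0 and nu = 0 if C > 0;
   the coordinate x_1 has index 0. *)
Definition flat_metric (R : realType) (n : nat) (C : R) (u v : 'rV[R]_n.+1) : R :=
  (-1) ^+ (C < 0)%R * u 0 0 * v 0 0
  + \sum_(i < n) u 0 (lift ord0 i) * v 0 (lift ord0 i).

Definition space_form (R : realType) (n : nat) (C : R) : set 'rV[R]_n.+1 :=
  [set p | flat_metric C p p = C^-1 /\ (C < 0 -> 0 < p 0 0)].
Arguments space_form {R} n C.

(* [space_form n C], used as a type, is the subtype of its points;
   [position] is the inclusion phi. *)
Definition position (R : realType) (n : nat) (C : R) (p : space_form n C) :
  'rV[R]_n.+1 := val p.

(* Maps on the embedded submanifold [space_form n C] are smooth when they extend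
   locally to smooth maps on open sets of the ambient space. *)
Definition local_extension (R : realType) (n : nat) (C : R) (W : normedModType R)
    (f : space_form n C -> W) (p : space_form n C) : set ('rV[R]_n.+1 -> W) :=
  [set F | exists U : set 'rV[R]_n.+1,
    [/\ open U, U (position p), smooth_on U F &
        forall q : space_form n C, U (position q) -> F (position q) = f q]].

Definition smooth (R : realType) (n : nat) (C : R) (W : normedModType R)
    (f : space_form n C -> W) : Prop :=
  forall p, exists F, local_extension f p F.

(* v(f) for a tangent vector v at p: the derivative along v of a local smooth
   extension of f, which for v tangent does not depend on the extension. *)
Definition tangent_derivative (R : realType) (n : nat) (C : R)
    (f : space_form n C -> R) (p : space_form n C) (v : 'rV[R]_n.+1) : R :=
  'D_v (xget (fun=> 0) (local_extension f p)) (position p).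

(* The tangent space at p is the kernel of the differential at p of the
   defining function q |-> <q, q>. *)
Definition tangent (R : realType) (n : nat) (C : R) (p : space_form n C)
    (v : 'rV[R]_n.+1) : Prop := flat_metric C (position p) v = 0.

Definition vector_field (R : realType) (n : nat) (C : R)
    (X : space_form n C -> 'rV[R]_n.+1) : Prop :=
  smooth X /\ forall p, tangent p (X p).

Definition field_apply (R : realType) (n : nat) (C : R)
    (X : space_form n C -> 'rV[R]_n.+1) (f : space_form n C -> R) :
    space_form n C -> R :=
  fun p => tangent_derivative f p (X p).

(* Z = [X, Y], vector fields being viewed as derivations. *)
Definition lie_bracket (R : realType) (n : nat) (C : R)
    (X Y Z : space_form n C -> 'rV[R]_n.+1) : Prop :=
  forall f : space_form n C -> R, smooth f -> forall p,
    field_apply Z f p = field_apply X (field_apply Y f) p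
                      - field_apply Y (field_apply X f) p.

(* [nabla X Y] is constrained only on smooth vector fields X, Y.  The metric on
   tangent vectors is the restriction of the flat metric. *)
Record levi_civita (R : realType) (n : nat) (C : R)
    (nabla : (space_form n C -> 'rV[R]_n.+1) -> (space_form n C -> 'rV[R]_n.+1) ->
             space_form n C -> 'rV[R]_n.+1) : Prop := LeviCivita {
  nabla_field : forall X Y, vector_field X -> vector_field Y ->
    vector_field (nabla X Y);
  nablaDl : forall X Y Z, vector_field X -> vector_field Y -> vector_field Z ->
    forall p, nabla (fun q => X q + Y q) Z p = nabla X Z p + nabla Y Z p;
  nablaZl : forall (f : space_form n C -> R) X Y,
    smooth f -> vector_field X -> vector_field Y ->
    forall p, nabla (fun q => f q *: X q) Y p = f p *: nabla X Y p;
  nablaDr : forall X Y Z, vector_field X -> vector_field Y -> vector_field Z ->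
    forall p, nabla X (fun q => Y q + Z q) p = nabla X Y p + nabla X Z p;
  nabla_leibniz : forall (f : space_form n C -> R) X Y,
    smooth f -> vector_field X -> vector_field Y ->
    forall p, nabla X (fun q => f q *: Y q) p
              = field_apply X f p *: Y p + f p *: nabla X Y p;
  nabla_torsion_free : forall X Y, vector_field X -> vector_field Y ->
    lie_bracket X Y (fun p => nabla X Y p - nabla Y X p);
  nabla_metric : forall X Y Z,
    vector_field X -> vector_field Y -> vector_field Z ->
    forall p, field_apply X (fun q => flat_metric C (Y q) (Z q)) p
              = flat_metric C (nabla X Y p) (Z p)
              + flat_metric C (Y p) (nabla X Z p)
}.

Definition concircular_factor (R : realType) (n : nat) (C : R)
    (nabla : (space_form n C -> 'rV[R]_n.+1) -> (space_form n C -> 'rV[R]_n.+1) ->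
             space_form n C -> 'rV[R]_n.+1)
    (V : space_form n C -> 'rV[R]_n.+1) (mu : space_form n C -> R) : Prop :=
  smooth mu /\
  forall X, vector_field X -> forall p, nabla X V p = mu p *: X p.

Definition concircular (R : realType) (n : nat) (C : R)
    (nabla : (space_form n C -> 'rV[R]_n.+1) -> (space_form n C -> 'rV[R]_n.+1) ->
             space_form n C -> 'rV[R]_n.+1)
    (V : space_form n C -> 'rV[R]_n.+1) : Prop :=
  exists mu, concircular_factor nabla V mu.

(* V p is the orthogonal projection of the constant vector p0 on the tangent
   space at p, for every p. *)
Definition is_tangential_part (R : realType) (n : nat) (C : R)
    (p0 : 'rV[R]_n.+1) (V : space_form n C -> 'rV[R]_n.+1) : Prop :=
  forall p, tangent p (V p) /\
    forall w, tangent p w -> flat_metric C (p0 - V p) w = 0.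

(* Main.v *)
(* For a smooth function f on M = M^n(C), the map x |-> f (x / sqrt (C <x, x>))
   extends f to an open cone of the flat space, and the derivatives of this
   extension along tangent vectors are the tangential derivatives D of f.
   Torsion-freeness and metric compatibility force the Gauss formula
   nabla_X Y = D_X Y + C <X, Y> phi.  If V is concircular with factor mu, this
   reads D_X V = mu X - C <X, V> phi, and applying the Lie bracket to the
   coordinates of V gives (X mu + C <X, V>) Y = (Y mu + C <Y, V>) X.  As n >= 2,
   it follows that X mu = - C <X, V>, so V - mu phi has zero derivative and is
   constant. *)
From HB Require Import structures.
From mathcomp Require Import ring lra.
Require Import Defs.
Import Order.TTheory GRing.Theory Num.Theory.
Set Implicit Arguments.
Unset Strict Implicit.
Unset Printing Implicit Defensive.
Local Open Scope classical_set_scope.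
Local Open Scope ring_scope.

(** * Differentiation in normed spaces: dependence on germs, chain rule, bilinear maps *)

Lemma near_eq_differentiable (R : numFieldType) (E W : normedModType R)
    (f g : E -> W) (x : E) :
  {near x, f =1 g} -> differentiable f x -> differentiable g x.
Proof.
move=> fg df.
(* The little-o expansion of [f] only sees its germ at [x], so ['d f x] also expands [g]; by
   uniqueness it is the differential of [g]. *)
have gE : g \o shift x = cst (g x) + 'd f x +o_ 0 id.
  apply/eqaddoP => _/posnumP[e].
  have /eqaddoP/(_ e%:num)/(_ [gt0 of e%:num]) := diff_locally df.
  apply: filter_app; rewrite -(nbhs_singleton fg).
  have : \forall h \near 0, f (h + x) = g (h + x).
    by move: fg; rewrite [X in X -> _](near_shift 0) subr0.
  apply: filter_app; near=> h => fgh.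
  by rewrite -[X in `|X| <= _ -> _]/(f (h + x) - _) fgh.
apply/diff_locallyP; rewrite (diff_unique (diff_continuous df) gE).
by split => //; exact: diff_continuous.
Unshelve. all: by end_near. Qed.

Lemma derive_comp (R : numFieldType) (E V W : normedModType R) (f : E -> V)
    (g : V -> W) (x v : E) : differentiable f x -> differentiable g (f x) ->
  'D_v (g \o f) x = 'D_('D_v f x) g (f x).
Proof.
move=> df dg; rewrite !deriveE//; last exact: differentiable_comp.
by rewrite diff_comp.
Qed.

Section bilinear.
Context {R : numFieldType} {E V1 V2 W : normedModType R}.
Context (B : {bilinear V1 -> V2 -> W}).
Hypothesis B_cont : continuous (fun q => B q.1 q.2).
Context (f : E -> V1) (g : E -> V2) (x : E).
Hypotheses (df : differentiable f x) (dg : differentiable g x).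

Let Bfg :
  (fun y => B (f y) (g y)) = (fun q => B q.1 q.2) \o (fun y => (f y, g y)).
Proof. by []. Qed.

Lemma differentiable_bilinear : differentiable (fun y => B (f y) (g y)) x.
Proof.
rewrite Bfg; apply: differentiable_comp; first exact: differentiable_pair.
exact: differentiable_bilin.
Qed.

Lemma derive_bilinear v :
  'D_v (fun y => B (f y) (g y)) x = B (f x) ('D_v g x) + B ('D_v f x) (g x).
Proof.
rewrite !deriveE//; last exact: differentiable_bilinear.
rewrite Bfg diff_comp//; first last.
- exact: differentiable_bilin.
- exact: differentiable_pair.
by rewrite /= diff_bilin// diff_pair.
Qed.

End bilinear.

(** * Stability of [C^k] maps on an open set *)

Section Ck_on.
Context {R : realType} {E : normedModType R}.
Implicit Types (U : set E) (k : nat).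

Lemma Ck_on_eq {W : normedModType R} k U (f g : E -> W) : open U ->
  (forall x, U x -> f x = g x) -> Ck_on k U f -> Ck_on k U g.
Proof.
move=> oU; elim: k f g => [|k IH] f g fg /=.
  move=> cf x Ux; rewrite /prop_for /continuous_at -(fg x Ux).
  apply: cvg_trans (cf x Ux); apply: near_eq_cvg; near=> y.
  by apply: fg; near: y; exact: open_nbhs_nbhs.
have nfg x : U x -> {near x, f =1 g}.
  by move=> Ux; near=> y; apply: fg; near: y; exact: open_nbhs_nbhs.
move=> [df Df]; split=> [x Ux|v].
  by apply: (near_eq_differentiable (nfg x Ux)); exact: df.
by apply: IH (Df v) => x Ux; exact/near_eq_derive/nfg.
Unshelve. all: by end_near. Qed.

Lemma Ck_on_sub {W : normedModType R} k U U' (f : E -> W) : U' `<=` U ->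
  Ck_on k U f -> Ck_on k U' f.
Proof.
move=> UU'; elim: k f => [|k IH] f /=; first by move=> cf x /UU' /cf.
by move=> [df Df]; split=> [x /UU' /df //|v]; exact: IH.
Qed.

Lemma Ck_onS {W : normedModType R} k U (f : E -> W) :
  Ck_on k.+1 U f -> Ck_on k U f.
Proof.
elim: k f => [|k IH] f; first by case=> df _ x /df/differentiable_continuous.
by move=> [df Df]; split=> // v; apply: IH; exact: Df.
Qed.

Lemma Ck_on_cst {W : normedModType R} k U (a : W) : Ck_on k U (cst a).
Proof.
elim: k a => [|k IH] a; first by move=> x _; exact: cvg_cst.
split=> [x _|v]; first exact: differentiable_cst.
by rewrite [X in Ck_on _ _ X](_ : _ = cst 0)//; apply/funext => x;
  rewrite derive_cst.
Qed.

Lemma Ck_on_id k U : Ck_on k U (@id E).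
Proof.
case: k => [|k]; first by move=> x _; exact: cvg_id.
split=> [x _|v]; first exact: ex_diff.
rewrite [X in Ck_on _ _ X](_ : _ = cst v); first exact: Ck_on_cst.
by apply/funext => x; rewrite derive_id.
Qed.

Lemma Ck_onD {W : normedModType R} k U (f g : E -> W) : open U ->
  Ck_on k U f -> Ck_on k U g -> Ck_on k U (f + g).
Proof.
move=> oU; elim: k f g => [|k IH] f g.
  by move=> cf cg x Ux; apply: cvgD; [exact: cf|exact: cg].
move=> [df Df] [dg Dg]; split=> [x Ux|v].
  by apply: differentiableD; [exact: df|exact: dg].
apply: Ck_on_eq (IH _ _ (Df v) (Dg v)) => // x Ux.
by rewrite deriveD//; apply: diff_derivable; [exact: df|exact: dg].
Qed.

(** By the Leibniz rule a derivative of [B f g] is a sum of two terms of the same shape, so the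
    induction on [k] runs over all [f] and [g] at once. *)
Lemma Ck_on_bilinear {V1 V2 W : normedModType R} (B : {bilinear V1 -> V2 -> W})
    k U (f : E -> V1) (g : E -> V2) :
  continuous (fun q => B q.1 q.2) -> open U ->
  Ck_on k U f -> Ck_on k U g -> Ck_on k U (fun x => B (f x) (g x)).
Proof.
move=> cB oU; elim: k f g => [|k IH] f g.
  move=> cf cg x Ux; rewrite /continuous_at.
  by apply: (cvg_comp2 (cf x Ux) (cg x Ux)); exact: (cB (f x, g x)).
move=> Cf Cg; have [df Df] := Cf; have [dg Dg] := Cg; split=> [x Ux|v].
  by apply: differentiable_bilinear => //; [exact: df|exact: dg].
have := Ck_onD oU (IH _ _ (Ck_onS Cf) (Dg v)) (IH _ _ (Df v) (Ck_onS Cg)).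
apply: Ck_on_eq => //.
by move=> x Ux; rewrite derive_bilinear//; [exact: df|exact: dg].
Qed.

End Ck_on.

(** With scaling registered as a bilinear map, one Leibniz rule serves both products by functions
    and the metric. *)
Lemma scale_is_bilinear (R : numFieldType) (W : normedModType R) :
  bilinear_for (GRing.Scale.Law.clone _ _ *:%R _)
    (GRing.Scale.Law.clone _ _ *:%R _) (@GRing.scale R W).
Proof.
split=> [w|a] b x y /=; first by rewrite scalerDl scalerA.
by rewrite scalerDr !scalerA (mulrC a).
Qed.

HB.instance Definition _ (R : numFieldType) (W : normedModType R) :=
  bilinear_isBilinear.Build R R W W _ _ (@GRing.scale R W)
    (@scale_is_bilinear R W).

(** * The flat metric as a symmetric nondegenerate bilinear form *)

Section flat_metric.
Context {R : realType} {n : nat} (C : R).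
Local Notation E := 'rV[R]_n.+1.
Local Notation "<[ u , v ]>" := (@flat_metric R n C u v).

Lemma flat_metric_is_bilinear :
  bilinear_for (GRing.Scale.Law.clone _ _ *:%R _)
    (GRing.Scale.Law.clone _ _ *:%R _) (@flat_metric R n C : E -> E -> R).
Proof.
split=> [w|w] b x y /=; rewrite /flat_metric !mxE.
- under eq_bigr do rewrite !mxE mulrDl -mulrA.
  by rewrite big_split/= -mulr_sumr /GRing.scale /=; ring.
- under eq_bigr do rewrite !mxE mulrDr mulrCA.
  by rewrite big_split/= -mulr_sumr /GRing.scale /=; ring.
Qed.

HB.instance Definition _ := bilinear_isBilinear.Build R E E R _ _
  (@flat_metric R n C) flat_metric_is_bilinear.

Lemma flat_metricDl u v w : <[u + v, w]> = <[u, w]> + <[v, w]>.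
Proof. exact: linearDl. Qed.

Lemma flat_metricBl u v w : <[u - v, w]> = <[u, w]> - <[v, w]>.
Proof. exact: linearBl. Qed.

Lemma flat_metricZl a u v : <[a *: u, v]> = a * <[u, v]>.
Proof. exact: linearZl_LR. Qed.

Lemma flat_metricC u v : <[u, v]> = <[v, u]>.
Proof.
by rewrite /flat_metric mulrAC; congr +%R; apply: eq_bigr => i _; rewrite mulrC.
Qed.

Lemma flat_metricDr u v w : <[u, v + w]> = <[u, v]> + <[u, w]>.
Proof. exact: linearDr. Qed.

Lemma flat_metricBr u v w : <[u, v - w]> = <[u, v]> - <[u, w]>.
Proof. exact: linearBr. Qed.

Lemma flat_metricZr a u v : <[u, a *: v]> = a * <[u, v]>.
Proof. exact: linearZr_LR. Qed.

Lemma flat_metric_continuous : continuous (fun q : E * E => <[q.1, q.2]>).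
Proof.
have c1 i (q : E * E) : (fun q : E * E => q.1 0 i : R) @ q --> (q.1 0 i : R).
  apply: (@continuous_comp _ _ _ fst (fun u : E => u 0 i) q).
    exact: cvg_fst.
  exact: coord_continuous.
have c2 i (q : E * E) : (fun q : E * E => q.2 0 i : R) @ q --> (q.2 0 i : R).
  apply: (@continuous_comp _ _ _ snd (fun u : E => u 0 i) q).
    exact: cvg_snd.
  exact: coord_continuous.
move=> q; apply: cvgD; first exact: cvgM (cvgM (cvg_cst _) (c1 _ _)) (c2 _ _).
apply: cvg_big => [|i _]; first exact: add_continuous.
by apply: cvgM; [exact: c1|exact: c2].
Qed.

(** Pairing with the basis vectors recovers the coordinates of [u], up to a sign for the first
    one. *)
Lemma flat_metric_nondeg u : (forall v, <[u, v]> = 0) -> u = 0.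
Proof.
move=> u0; apply/rowP => j; rewrite mxE; have := u0 (delta_mx 0 j).
rewrite /flat_metric !mxE /=; case: (unliftP ord0 j) => [k|] ->.
  rewrite mulr0 add0r (bigD1 k)//= big1 => [|i ik]; rewrite mxE.
    by rewrite !eqxx mulr1 addr0.
  by rewrite (inj_eq lift_inj) (negPf ik) mulr0.
rewrite big1 => [|i _]; last by rewrite mxE /= mulr0.
by rewrite eqxx mulr1 addr0 => /eqP; rewrite mulf_eq0 signr_eq0 => /eqP.
Qed.

Lemma flat_metric_ge0 u : 0 < C -> 0 <= <[u, u]>.
Proof.
move=> C0; rewrite /flat_metric ltNge (ltW C0) expr0 mul1r -expr2.
by rewrite addr_ge0 ?sqr_ge0// sumr_ge0// => i _; rewrite -expr2 sqr_ge0.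
Qed.

Lemma flat_metric_eq0 u : 0 < C -> <[u, u]> = 0 -> u = 0.
Proof.
move=> C0; rewrite /flat_metric ltNge (ltW C0) expr0 mul1r -expr2 => /eqP.
rewrite paddr_eq0 ?sqr_ge0//; last first.
  by rewrite sumr_ge0// => i _; rewrite -expr2 sqr_ge0.
rewrite sqrf_eq0 psumr_eq0 => [/andP[/eqP u0 /allP us]|i _]; last first.
  by rewrite -expr2 sqr_ge0.
apply/rowP => j; rewrite mxE; case: (unliftP ord0 j) => [k|] -> //.
by have := us k (mem_index_enum _); rewrite -expr2 sqrf_eq0 => /eqP.
Qed.

End flat_metric.

(** * Radial projection of an open cone onto the space form *)

Section projection.
Context {R : realType} {n : nat} {C : R} (C_neq0 : C != 0).
Local Notation E := 'rV[R]_n.+1.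
Local Notation "<[ u , v ]>" := (@flat_metric R n C u v).
Implicit Types (p q : space_form n C) (x v : E).

Lemma metric_position p : <[position p, position p]> = C^-1.
Proof. by have /set_mem[] := valP p. Qed.

Lemma position_inj : injective (@position R n C).
Proof. exact: val_inj. Qed.

(** The factor [C] treats both signs at once: this is the complement of the origin if [C > 0], and
    the open future light cone if [C < 0]. *)
Definition cone : set E := [set x | 0 < C * <[x, x]> /\ (C < 0 -> 0 < x 0 0)].

Lemma position_cone p : cone (position p).
Proof.
have /set_mem[pp p0] := valP p; split=> //.
by rewrite metric_position mulfV// ltr01.
Qed.

Lemma differentiable_sqnorm x : differentiable (fun y : E => <[y, y]>) x.
Proof.
apply: (@differentiable_bilinear _ _ _ _ _ (@flat_metric R n C)) => //.
exact: flat_metric_continuous.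
Qed.

Lemma derive_sqnorm x v : 'D_v (fun y : E => <[y, y]>) x = <[x, v]> *+ 2.
Proof.
rewrite (@derive_bilinear _ _ _ _ _ (@flat_metric R n C) _ id id)//.
  by rewrite derive_id /= mulr2n (flat_metricC C v).
exact: flat_metric_continuous.
Qed.

Lemma cone_open : open cone.
Proof.
rewrite (_ : cone = (fun x : E => C * <[x, x]>) @^-1` [set t | 0 < t] `&`
  [set x : E | C < 0 -> 0 < x 0 0])//.
apply: openI.
  apply: open_comp; last exact: open_gt.
  move=> x _.
  exact: cvgM (cvg_cst _) (differentiable_continuous (differentiable_sqnorm x)).
have [C0|C0] := ltP C 0; last first.
  rewrite (_ : [set _ | _] = setT); first exact: openT.
  by apply/seteqP; split=> x.
rewrite (_ : [set _ | _] = (fun x : E => x 0 0) @^-1` [set t | 0 < t]).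
  by apply: open_comp => [x _|]; [exact: coord_continuous|exact: open_gt].
by apply/seteqP; split=> x /= => [|? _]; exact.
Qed.

Definition normalize x : E := (Num.sqrt (C * <[x, x]>))^-1 *: x.

Lemma normalize_space_form x : cone x -> space_form n C (normalize x).
Proof.
move=> [x0 xC]; split; last first.
  by move=> /xC xC0; rewrite mxE mulr_gt0// invr_gt0 sqrtr_gt0.
rewrite flat_metricZl flat_metricZr mulrA -invfM -expr2.
rewrite sqr_sqrtr; last exact: ltW.
by rewrite invfM mulfVK//; apply: contraTneq x0 => ->; rewrite mulr0 ltxx.
Qed.

Lemma normalize_position p : normalize (position p) = position p.
Proof. by rewrite /normalize metric_position mulfV// sqrtr1 invr1 scale1r. Qed.

Lemma differentiable_inv_sqrt x : cone x ->
  differentiable (fun t : R => (Num.sqrt (C * t))^-1) <[x, x]>.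
Proof.
move=> [x0 _]; apply: differentiableV; last by rewrite gt_eqF// sqrtr_gt0.
apply: (@differentiable_comp _ _ _ _ (fun t : R => C * t)).
  by apply: differentiableM; [exact: differentiable_cst|exact: ex_diff].
by apply/derivable1_diffP; have [] := is_derive1_sqrt x0.
Qed.

Lemma differentiable_invnorm x : cone x ->
  differentiable (fun y : E => (Num.sqrt (C * <[y, y]>))^-1) x.
Proof.
move=> /differentiable_inv_sqrt dx.
apply: (@differentiable_comp _ _ _ _ (fun y : E => <[y, y]>)) dx.
exact: differentiable_sqnorm.
Qed.

Lemma differentiable_normalize x : cone x -> differentiable normalize x.
Proof.
move=> xC; apply: (@differentiable_bilinear _ _ _ _ _ *:%R).
- exact: scale_continuous.
- exact: differentiable_invnorm.
- by [].
Qed.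

(** The derivative of [<y, y>] along [v] is [2 <p, v> = 0], so the scaling factor, equal to 1 at
    [p], is stationary. *)
Lemma derive_normalize p v : tangent p v -> 'D_v normalize (position p) = v.
Proof.
move=> pv; have pC := position_cone p.
rewrite (@derive_bilinear _ _ _ _ _ *:%R)//; last 2 first.
- exact: scale_continuous.
- exact: differentiable_invnorm.
rewrite /= derive_id metric_position mulfV// sqrtr1 invr1 scale1r.
rewrite (@derive_comp _ _ _ _ (fun y : E => <[y, y]>)
  (fun t : R => (Num.sqrt (C * t))^-1))/=; last 2 first.
- exact: differentiable_sqnorm.
- exact: differentiable_inv_sqrt.
by rewrite derive_sqnorm pv mul0rn derive0 scale0r addr0.
Qed.

(** Differentiate [<normalize y, normalize y>], which is constant on the cone. *)
Lemma tangent_derive_normalize x v : cone x ->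
  <[normalize x, 'D_v normalize x]> = 0.
Proof.
move=> xC; have dn := differentiable_normalize xC.
have : 'D_v (fun y => <[normalize y, normalize y]>) x = 0.
  rewrite -(derive_cst (C^-1 : R) x v).
  apply: near_eq_derive; near=> y.
  have /normalize_space_form[-> //] : cone y.
  by near: y; apply: open_nbhs_nbhs; split => //; exact: cone_open.
rewrite (derive_bilinear (B := @flat_metric R n C))//; last first.
  exact: flat_metric_continuous.
rewrite /= (flat_metricC C ('D_v _ _)) -mulr2n => /eqP.
by rewrite mulrn_eq0 => /eqP.
Unshelve. all: by end_near. Qed.

Definition proj p x : space_form n C := insubd p (normalize x).

Lemma position_proj p x : cone x -> position (proj p x) = normalize x.
Proof.
by move=> /normalize_space_form xM; rewrite /position val_insubd mem_set.
Qed.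

Lemma proj_position p q : proj p (position q) = q.
Proof.
apply: position_inj; rewrite position_proj ?normalize_position//.
exact: position_cone.
Qed.

End projection.

Arguments cone {R n} C _.
Arguments normalize {R n} C _.

(** * Smooth maps on the space form *)

Section smooth.
Context {R : realType} {n : nat} {C : R}.
Implicit Types (V W : normedModType R) (p : space_form n C).

Lemma smooth_cst W (a : W) : @smooth R n C W (fun=> a).
Proof.
move=> p; exists (cst a), setT; split=> //; first exact: openT.
by move=> k; exact: Ck_on_cst.
Qed.

Lemma smooth_position : smooth (@position R n C).
Proof.
move=> p; exists id, setT; split=> //; first exact: openT.
by move=> k; exact: Ck_on_id.
Qed.

Lemma smoothD W (f g : space_form n C -> W) :
  smooth f -> smooth g -> smooth (fun q => f q + g q).
Proof.
move=> sf sg p; have [F [U [oU Up sF Ff]]] := sf p.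
have [G [U' [oU' U'p sG Gg]]] := sg p.
exists (F + G), (U `&` U'); split=> [||k|q [Uq U'q]].
- exact: openI.
- by [].
- apply: Ck_onD; first exact: openI.
    by apply: Ck_on_sub (sF k); exact: subIsetl.
  by apply: Ck_on_sub (sG k); exact: subIsetr.
- by rewrite -Ff// -Gg.
Qed.

Lemma smooth_bilinear V1 V2 W (B : {bilinear V1 -> V2 -> W})
    (f : space_form n C -> V1) (g : space_form n C -> V2) :
  continuous (fun u => B u.1 u.2) -> smooth f -> smooth g ->
  smooth (fun q => B (f q) (g q)).
Proof.
move=> cB sf sg p; have [F [U [oU Up sF Ff]]] := sf p.
have [G [U' [oU' U'p sG Gg]]] := sg p.
exists (fun x => B (F x) (G x)), (U `&` U'); split=> [||k|q [Uq U'q]].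
- exact: openI.
- by [].
- apply: Ck_on_bilinear => //; first exact: openI.
    by apply: Ck_on_sub (sF k); exact: subIsetl.
  by apply: Ck_on_sub (sG k); exact: subIsetr.
- by rewrite Ff// Gg.
Qed.

Lemma smoothZ W (f : space_form n C -> R) (g : space_form n C -> W) :
  smooth f -> smooth g -> smooth (fun q => f q *: g q).
Proof. by apply: (@smooth_bilinear _ _ _ *:%R); exact: scale_continuous. Qed.

Lemma smooth_flat_metric (f g : space_form n C -> 'rV[R]_n.+1) :
  smooth f -> smooth g -> smooth (fun q => flat_metric C (f q) (g q)).
Proof.
apply: (@smooth_bilinear _ _ _ (@flat_metric R n C)).
exact: flat_metric_continuous.
Qed.

End smooth.

(* The derivative of f along v, computed on the extension of f to the cone that
   is homogeneous of degree 0; p is only a default value in [proj p].  The lock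
   keeps unification from unfolding the derivative. *)
HB.lock Definition dirD (R : realType) (n : nat) (C : R) (W : normedModType R)
    (f : space_form n C -> W) (p : space_form n C) (v : 'rV[R]_n.+1) : W :=
  'D_v (f \o proj p) (position p).

(** * Tangential derivatives of maps on the space form *)

Section directional_derivative.
Context {R : realType} {n : nat} {C : R} (C_neq0 : C != 0).
Local Notation E := 'rV[R]_n.+1.
Local Notation "<[ u , v ]>" := (@flat_metric R n C u v).
Implicit Types (V W : normedModType R) (p q : space_form n C) (x v : E).

Lemma near_cone x : cone C x -> \forall y \near x, cone C y.
Proof. by move=> xC; apply: open_nbhs_nbhs; split => //; exact: cone_open. Qed.

(** A local extension [F] turns [f \o proj p] into a composite of maps between normed spaces, to
    which the chain rule applies. *)
Lemma near_proj W (f : space_form n C -> W) p x (F : E -> W) (U : set E) :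
  open U -> U (position (proj p x)) -> cone C x ->
  (forall q, U (position q) -> F (position q) = f q) ->
  {near x, F \o normalize C =1 f \o proj p}.
Proof.
move=> oU Ux xC Ff; near=> y.
have yC : cone C y by near: y; exact: near_cone.
rewrite /= -(position_proj p yC) Ff// position_proj//; near: y.
have cn := differentiable_continuous (differentiable_normalize xC).
by apply: cn; apply: open_nbhs_nbhs; split=> //; rewrite -(position_proj p).
Unshelve. all: by end_near. Qed.

Lemma differentiable_proj W (f : space_form n C -> W) p x :
  smooth f -> cone C x -> differentiable (f \o proj p) x.
Proof.
move=> sf xC; have [F [U [oU Ux sF Ff]]] := sf (proj p x).
apply: (near_eq_differentiable (near_proj oU Ux xC Ff)).
apply: differentiable_comp; first exact: differentiable_normalize.
by have [dF _] := sF 1%N; apply: dF; rewrite -(position_proj p).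
Qed.

(** Since [normalize] has derivative [v] along a tangent [v], any local extension [F] and
    [F \o normalize C] have the same derivative there. *)
Lemma tangent_derivativeE (f : space_form n C -> R) p v :
  smooth f -> tangent p v -> tangent_derivative f p v = dirD f p v.
Proof.
move=> sf pv; rewrite /tangent_derivative.
(* Smoothness of [f] ensures that the extension picked by choice is a genuine one, not the default
   zero map. *)
have [U [oU Up sF Ff]] := xgetPex (fun=> 0) (sf p).
set F := xget _ _ in sF Ff *.
have pC := position_cone C_neq0 p.
have Up' : U (position (proj p (position p))) by rewrite proj_position.
rewrite dirD.unlock -(near_eq_derive v (near_proj oU Up' pC Ff)).
have dF : differentiable F (normalize C (position p)).
  by have [dF _] := sF 1%N; apply: dF; rewrite normalize_position.
rewrite (derive_comp v (differentiable_normalize pC) dF).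
by rewrite derive_normalize// normalize_position.
Qed.

(** Projecting twice is projecting once, so the chain rule carries the derivative from any point of
    the cone to the space form. *)
Lemma derive_proj W (f : space_form n C -> W) p x v : smooth f -> cone C x ->
  'D_v (f \o proj p) x = dirD f (proj p x) ('D_v (normalize C) x).
Proof.
move=> sf xC; have dn := differentiable_normalize xC.
have df : differentiable (f \o proj (proj p x)) (normalize C x).
  apply: differentiable_proj => //; rewrite -(position_proj p xC).
  exact: position_cone.
rewrite dirD.unlock position_proj// -(derive_comp v dn df).
apply: near_eq_derive.
near=> y; have yC : cone C y by near: y; exact: near_cone.
by rewrite /= -(position_proj p yC) proj_position.
Unshelve. all: by end_near. Qed.

Lemma dirD_cst W (a : W) p v : dirD (fun=> a) p v = 0.
Proof. by rewrite dirD.unlock; exact: derive_cst. Qed.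

Lemma dirD_position p v : tangent p v -> dirD (@position R n C) p v = v.
Proof.
move=> pv; rewrite dirD.unlock -[RHS](derive_normalize C_neq0 pv).
apply: near_eq_derive; near=> y; rewrite /= position_proj//; near: y.
exact/near_cone/position_cone.
Unshelve. all: by end_near. Qed.

Lemma dirDD W (f g : space_form n C -> W) p v : smooth f -> smooth g ->
  dirD (fun q => f q + g q) p v = dirD f p v + dirD g p v.
Proof.
move=> sf sg; rewrite dirD.unlock.
by apply: deriveD; apply/diff_derivable/differentiable_proj => //;
  exact: position_cone.
Qed.

Lemma dirD_bilinear V1 V2 W (B : {bilinear V1 -> V2 -> W})
    (f : space_form n C -> V1) (g : space_form n C -> V2) p v :
  continuous (fun u => B u.1 u.2) -> smooth f -> smooth g ->
  dirD (fun q => B (f q) (g q)) p v =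
  B (f p) (dirD g p v) + B (dirD f p v) (g p).
Proof.
move=> cB sf sg; have pC := position_cone C_neq0 p.
rewrite dirD.unlock.
rewrite (@derive_bilinear _ _ _ _ _ B cB (f \o proj p) (g \o proj p))/=.
- by rewrite !proj_position.
- exact: differentiable_proj.
- exact: differentiable_proj.
Qed.

Lemma dirDZ W (f : space_form n C -> R) (g : space_form n C -> W) p v :
  smooth f -> smooth g ->
  dirD (fun q => f q *: g q) p v = f p *: dirD g p v + dirD f p v *: g p.
Proof. by apply: (@dirD_bilinear _ _ _ *:%R); exact: scale_continuous. Qed.

Lemma dirD_flat_metric (f g : space_form n C -> E) p v : smooth f -> smooth g ->
  dirD (fun q => <[f q, g q]>) p v = <[f p, dirD g p v]> + <[dirD f p v, g p]>.
Proof.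
apply: (@dirD_bilinear _ _ _ (@flat_metric R n C)).
exact: flat_metric_continuous.
Qed.

End directional_derivative.

(** Used to find a vector outside the span of one or two given ones: some row of the identity matrix
    must escape a row space of smaller rank. *)
Lemma exists_not_submx (F : fieldType) (m n : nat) (A : 'M[F]_(m, n)) :
  (\rank A < n)%N -> exists a : 'rV[F]_n, ~~ (a <= A)%MS.
Proof.
move=> rA.
have /row_subPn[i iA] : ~~ (1%:M <= A)%MS; last by exists (row i 1%:M).
by apply/negP => /mxrankS; rewrite mxrank1 leqNgt rA.
Qed.

(** * Tangent spaces and tangential parts of constant vectors *)

Section tangent_space.
Context {R : realType} {n : nat} {C : R} (C_neq0 : C != 0).
Local Notation E := 'rV[R]_n.+1.
Local Notation "<[ u , v ]>" := (@flat_metric R n C u v).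
Implicit Types (p q : space_form n C) (u v w : E).

(** As [<p, p> = 1/C], the normal component of [u] at [p] is [C <u, p> p]. *)
Definition tangential u p : E := u + (- C * <[u, position p]>) *: position p.

Lemma tangent_tangential u p : tangent p (tangential u p).
Proof.
rewrite /tangent flat_metricDr flat_metricZr metric_position.
by rewrite (flat_metricC C u) !mulNr mulrAC mulfV// mul1r subrr.
Qed.

Lemma metric_tangential u p w : tangent p w -> <[tangential u p, w]> = <[u, w]>.
Proof. by move=> pw; rewrite flat_metricDl flat_metricZl pw mulr0 addr0. Qed.

Lemma tangential_id u p : tangent p u -> tangential u p = u.
Proof.
by move=> pu; rewrite /tangential flat_metricC pu mulr0 scale0r addr0.
Qed.

Lemma smooth_tangential u : smooth (tangential u).
Proof.
apply: smoothD; first exact: smooth_cst.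
apply: smoothZ; last exact: smooth_position.
apply: (@smoothZ _ _ _ R); first exact: smooth_cst.
apply: smooth_flat_metric; [exact: smooth_cst|exact: smooth_position].
Qed.

Lemma vector_field_tangential u : vector_field (tangential u).
Proof. by split; [exact: smooth_tangential|exact: tangent_tangential]. Qed.

(** An ambient vector differs from its tangential part by a multiple of [position p], which is
    orthogonal to [u]; so nondegeneracy of the flat metric suffices. *)
Lemma tangent_nondeg p u : tangent p u ->
  (forall w, tangent p w -> <[u, w]> = 0) -> u = 0.
Proof.
move=> pu u0; apply: (@flat_metric_nondeg _ _ C) => w; rewrite flat_metricC.
rewrite -(metric_tangential _ pu) flat_metricC u0//.
exact: tangent_tangential.
Qed.

Lemma is_tangential_partP u (V : space_form n C -> E) :
  is_tangential_part u V <-> V = tangential u.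
Proof.
split=> [uV|-> p]; last first.
  split=> [|w pw]; first exact: tangent_tangential.
  by rewrite flat_metricBl metric_tangential// subrr.
apply/funext => p; have [pV Vw] := uV p; apply/eqP.
rewrite eq_sym -subr_eq0; apply/eqP/(@tangent_nondeg p) => [|w pw].
  by rewrite /tangent flat_metricBr pV tangent_tangential subrr.
by rewrite flat_metricBl metric_tangential// -flat_metricBl Vw.
Qed.

(** The coefficient of [v] will be the concircular factor; the normal term is the one that the Gauss
    formula cancels. *)
Lemma dirD_tangential u p v : tangent p v ->
  dirD (tangential u) p v =
  (- C * <[u, position p]>) *: v + (- C * <[u, v]>) *: position p.
Proof.
move=> pv; have su : smooth (fun q : space_form n C => <[u, position q]>).
  by apply: smooth_flat_metric; [exact: smooth_cst|exact: smooth_position].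
have sCu : smooth (fun q : space_form n C => - C *: <[u, position q]>).
  by apply: (@smoothZ _ _ _ R) su; exact: smooth_cst.
rewrite /tangential dirDD//; last 2 first.
- exact: smooth_cst.
- by apply: smoothZ => //; exact: smooth_position.
rewrite dirD_cst add0r dirDZ//; last exact: smooth_position.
rewrite dirD_position// (@dirDZ _ _ _ C_neq0 R)//; last exact: smooth_cst.
rewrite dirD_cst scale0r addr0 dirD_flat_metric//; last 2 first.
- exact: smooth_cst.
- exact: smooth_position.
by rewrite dirD_position// dirD_cst linear0l addr0.
Qed.

Lemma exists_tangent_neq0 p : (0 < n)%N -> exists2 v, tangent p v & v != 0.
Proof.
move=> n0; have [|a ap] := @exists_not_submx _ _ _ (position p).
  by rewrite (leq_ltn_trans (rank_leq_row _)).
exists (tangential a p); first exact: tangent_tangential.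
apply: contra ap; rewrite /tangential addr_eq0 => /eqP ->.
by rewrite -scaleNr; exact: scalemx_sub.
Qed.

End tangent_space.

(** * The Gauss formula for a Levi-Civita connection *)

Section levi_civita.
Context {R : realType} {n : nat} {C : R} (C_neq0 : C != 0).
Local Notation E := 'rV[R]_n.+1.
Local Notation M := (space_form n C).
Local Notation "<[ u , v ]>" := (@flat_metric R n C u v).
Context (nabla : (M -> E) -> (M -> E) -> M -> E).
Hypothesis nablaLC : levi_civita nabla.
Implicit Types (p q : M) (u v w : E) (X Y Z V : M -> E).

Lemma field_applyE X (f : M -> R) : vector_field X -> smooth f ->
  field_apply X f = fun q => dirD f q (X q).
Proof.
move=> [_ tX] sf; apply/funext => q.
by rewrite /field_apply tangent_derivativeE.
Qed.

Lemma dirD_metric_cst u (g : M -> E) p v : smooth g ->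
  dirD (fun q => <[u, g q]>) p v = <[u, dirD g p v]>.
Proof.
move=> sg; rewrite dirD_flat_metric//; last exact: smooth_cst.
by rewrite dirD_cst linear0l addr0.
Qed.

Lemma smooth_metric_cst u (g : M -> E) :
  smooth g -> smooth (fun q => <[u, g q]>).
Proof. by apply: smooth_flat_metric; exact: smooth_cst. Qed.

(** Brackets act on scalar functions, so torsion-freeness is applied to [<u, g>] for each constant
    [u], and nondegeneracy gives the vector identity. It serves for [g] the position and for [g] a
    concircular field. *)
Lemma dirD_bracket (g : M -> E) X Y p : smooth g ->
  vector_field X -> vector_field Y ->
  smooth (fun q => dirD g q (X q)) -> smooth (fun q => dirD g q (Y q)) ->
  dirD g p (nabla X Y p - nabla Y X p) =
  dirD (fun q => dirD g q (Y q)) p (X p)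
  - dirD (fun q => dirD g q (X q)) p (Y p).
Proof.
move=> sg vX vY sX sY; apply/eqP; rewrite -subr_eq0; apply/eqP.
apply: (@flat_metric_nondeg _ _ C) => u; rewrite flat_metricC.
have := nabla_torsion_free nablaLC vX vY (smooth_metric_cst u sg) p.
have appl Z : vector_field Z ->
    field_apply Z (fun q => <[u, g q]>) = fun q => <[u, dirD g q (Z q)]>.
  move=> vZ; rewrite field_applyE//; last exact: smooth_metric_cst.
  by apply/funext => q; rewrite dirD_metric_cst.
rewrite (appl _ vX) (appl _ vY) {1}/field_apply tangent_derivativeE//.
- rewrite !field_applyE//; [|exact: smooth_metric_cst..].
  rewrite (dirD_metric_cst _ _ _ sX) (dirD_metric_cst _ _ _ sY).
  by rewrite dirD_metric_cst// !flat_metricBr => ->; rewrite subrr.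
- exact: smooth_metric_cst.
- have [_ tXY] := nabla_field nablaLC vX vY.
  have [_ tYX] := nabla_field nablaLC vY vX.
  by rewrite /tangent flat_metricBr tXY tYX subrr.
Qed.

Lemma nabla_tangent X Y p : vector_field X -> vector_field Y ->
  tangent p (nabla X Y p).
Proof. by move=> vX vY; have [_] := nabla_field nablaLC vX vY. Qed.

(** The bracket identity for the position map, whose derivative along a field is the field
    itself. *)
Lemma nabla_torsion X Y p : vector_field X -> vector_field Y ->
  nabla X Y p - nabla Y X p = dirD Y p (X p) - dirD X p (Y p).
Proof.
move=> vX vY; have [sX tX] := vX; have [sY tY] := vY.
have dpos Z : vector_field Z -> (fun q => dirD (@position _ _ _) q (Z q)) = Z.
  by move=> [_ tZ]; apply/funext => q; rewrite dirD_position.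
have := @dirD_bracket _ X Y p smooth_position vX vY.
rewrite !dpos// dirD_position//; first by apply.
by rewrite /tangent flat_metricBr !nabla_tangent// subrr.
Qed.

(** Differentiate [<position, Y> = 0] along [v]. *)
Lemma position_dirD Y p v : vector_field Y -> tangent p v ->
  <[position p, dirD Y p v]> = - <[v, Y p]>.
Proof.
move=> [sY tY] pv; apply/eqP; rewrite -addr_eq0.
rewrite -[X in _ + <[X, _]>](dirD_position C_neq0 pv).
rewrite -dirD_flat_metric//; last exact: smooth_position.
rewrite (_ : (fun q => _) = fun=> 0) ?dirD_cst//.
by apply/funext => q; exact: tY.
Qed.

Lemma nablaE X Y p : vector_field X -> vector_field Y ->
  nabla X Y p = dirD Y p (X p) + (C * <[X p, Y p]>) *: position p.
Proof.
move=> vX vY.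
(* <S X Y, Z> is symmetric in X, Y and skew in Y, Z, hence zero. *)
pose S X Y : E := nabla X Y p - dirD Y p (X p).
have SC X1 X2 : vector_field X1 -> vector_field X2 -> S X1 X2 = S X2 X1.
  move=> v1 v2; have /eqP := nabla_torsion p v1 v2.
  rewrite subr_eq /S => /eqP ->.
  by rewrite addrAC (addrAC (dirD _ _ _)) subrr add0r addrC.
have Sskew X1 X2 X3 : vector_field X1 -> vector_field X2 -> vector_field X3 ->
    <[S X1 X2, X3 p]> = - <[S X1 X3, X2 p]>.
  move=> v1 v2 v3; have := nabla_metric nablaLC v1 v2 v3 p.
  have [[s1 t1] [s2 t2] [s3 t3]] := And3 v1 v2 v3.
  rewrite field_applyE//; last exact: smooth_flat_metric.
  rewrite dirD_flat_metric// /S !flat_metricBl (flat_metricC C (X2 p)).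
  rewrite (flat_metricC C (X2 p)); lra.
have S0 Z : vector_field Z -> <[S X Y, Z p]> = 0.
  move=> vZ; have e1 := Sskew _ _ _ vX vY vZ.
  have e2 := Sskew _ _ _ vY vX vZ; have e3 := Sskew _ _ _ vZ vX vY.
  rewrite (SC _ _ vZ vX) (SC _ _ vZ vY) in e3; rewrite (SC _ _ vY vX) in e2.
  lra.
apply/eqP; rewrite -subr_eq0 opprD addrA -/(S X Y); apply/eqP.
have tX : tangent p (X p) by case: vX.
(* First the difference is shown tangent: by [position_dirD], the added multiple of [position p]
   cancels the normal component of [dirD Y p (X p)]. *)
apply: (@tangent_nondeg _ _ _ C_neq0 p) => [|w pw].
  rewrite /tangent !flat_metricBr nabla_tangent// position_dirD//.
  rewrite flat_metricZr metric_position mulrAC mulfV// mul1r.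
  by rewrite sub0r opprK subrr.
rewrite flat_metricBl flat_metricZl [X in _ * X]pw mulr0 subr0.
(* A single tangent vector [w] is the value at [p] of the global field [tangential w]. *)
have := S0 _ (vector_field_tangential C_neq0 w).
by rewrite tangential_id.
Qed.

Lemma nabla_tangential u X p : vector_field X ->
  nabla X (tangential u) p = (- C * <[u, position p]>) *: X p.
Proof.
move=> vX; have tX : tangent p (X p) by case: vX.
rewrite nablaE//; last exact: vector_field_tangential.
rewrite dirD_tangential// (flat_metricC C (X p)) metric_tangential//.
by rewrite !mulNr !scaleNr subrK.
Qed.

End levi_civita.

(** * Maps with zero tangential derivative are constant *)

Section connected.
Context {R : realType} {n : nat} {C : R} (C_neq0 : C != 0).
Local Notation E := 'rV[R]_n.+1.
Local Notation M := (space_form n C).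
Local Notation "<[ u , v ]>" := (@flat_metric R n C u v).
Implicit Types (p q : M) (u v w : E).

Lemma segment_cone p q (t : R) : 0 < 1 + C * <[position p, position q]> ->
  0 <= t <= 1 -> cone C (position p + t *: (position q - position p)).
Proof.
move=> pq /andP[t0 t1]; have [_ p0] := position_cone C_neq0 p.
have [_ q0] := position_cone C_neq0 q; split=> [|C0]; last first.
  by rewrite !mxE; have := p0 C0; have := q0 C0; nra.
rewrite scalerBr addrCA -[X in _ + (X - _)]scale1r -scalerBl.
rewrite !(flat_metricDl, flat_metricDr, flat_metricZl, flat_metricZr).
rewrite !metric_position (flat_metricC C (position q)).
set c := <[_, _]> in pq *.
(* Both terms are nonnegative on the chord; the square vanishes only at the midpoint, where the
   other term is positive. *)
rewrite [ltRHS](_ : _ = (1 - 2 * t) ^+ 2 + 2 * (t * (1 - t) * (1 + C * c))).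
  have [t12|t12] := eqVneq (1 - 2 * t) 0.
    by rewrite t12 expr0n add0r !mulr_gt0//; lra.
  rewrite ltr_pwDl// ?exprn_even_gt0//.
  by rewrite !mulr_ge0 ?subr_ge0 ?(ltW pq).
by field.
Qed.

(** Reverse Cauchy-Schwarz inequality for timelike vectors of the same sheet, obtained by expanding
    a sum of squares. *)
Lemma hyperbolic_metric_gt0 p q : C < 0 -> 0 < C * <[position p, position q]>.
Proof.
move=> C0; have [_ /(_ C0) p0] := position_cone C_neq0 p.
have [_ /(_ C0) q0] := position_cone C_neq0 q.
rewrite nmulr_rgt0//; have := metric_position p; have := metric_position q.
rewrite /flat_metric C0 expr1.
move: (position p) (position q) p0 q0 => x y x0 y0.
have CV : C^-1 < 0 by rewrite invr_lt0.
have : 0 <= \sum_(i < n)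
    (x 0 (lift ord0 i) * y 0 0 - y 0 (lift ord0 i) * x 0 0) ^+ 2.
  by apply: sumr_ge0 => i _; exact: sqr_ge0.
have sqrE (a b c d : R) : (a * d - c * b) ^+ 2 =
    d ^+ 2 * (a * a) + b ^+ 2 * (c * c) - (2 * b * d) * (a * c) by ring.
under eq_bigr do rewrite sqrE.
rewrite !big_split/= sumrN -!mulr_sumr.
set P := \sum_(i < n) (x _ _ * x _ _); set Q := \sum_(i < n) (y _ _ * y _ _).
set S := \sum_(i < n) (x _ _ * y _ _) => PQS Qe Pe.
have {}Pe : P = C^-1 + x 0 0 ^+ 2 by lra.
have {}Qe : Q = C^-1 + y 0 0 ^+ 2 by lra.
have {}PQS : 0 < 2 * x 0 0 * y 0 0 * (x 0 0 * y 0 0 - S).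
  have xV : C^-1 * x 0 0 ^+ 2 < 0 by rewrite nmulr_rlt0// exprn_gt0.
  have yV : C^-1 * y 0 0 ^+ 2 < 0 by rewrite nmulr_rlt0// exprn_gt0.
  rewrite Pe Qe in PQS; lra.
move: PQS; rewrite pmulr_rgt0 ?mulr_gt0//; lra.
Qed.


(** Positivity of [C <p + q, p + q> = 2 (1 + C <p, q>)]. *)
Lemma sphere_metric_gtN1 p q : 0 < C -> position q != - position p ->
  0 < 1 + C * <[position p, position q]>.
Proof.
move=> C0 qp; set x := position p + position q.
have : 0 < C * <[x, x]>.
  rewrite mulr_gt0// lt_neqAle flat_metric_ge0// andbT eq_sym.
  apply: contra qp => /eqP/(flat_metric_eq0 C0)/eqP.
  by rewrite /x addrC addr_eq0.
rewrite /x !(flat_metricDl, flat_metricDr) !metric_position.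
rewrite (flat_metricC C (position q)).
have : C * C^-1 = 1 by rewrite mulfV.
nra.
Qed.

Context (g : M -> E).
Hypothesis g_smooth : smooth g.
Hypothesis dg0 : forall p v, tangent p v -> dirD g p v = 0.

Lemma dirD0_eq_segment p q :
  0 < 1 + C * <[position p, position q]> -> g p = g q.
Proof.
move=> pq; apply/rowP => j; pose v := position q - position p.
(* The chord stays in the cone, so each coordinate of [g] can be followed along its projection and
   the mean value theorem applied. *)
pose h (t : R) : R := (g (proj p (position p + t *: v))) 0 j.
have h0 (t : R) : 0 <= t <= 1 -> is_derive t 1 h 0.
  move=> /(segment_cone pq) tC.
  pose G := g \o proj p; pose gam (t : R) : E := position p + t *: v.
  have dG : differentiable G (gam t) by exact: differentiable_proj.
  have dgam : differentiable gam t.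
    have : differentiable (cst (position p) + ( *:%R^~ v : R -> E)) t.
      by apply: differentiableD; [exact: differentiable_cst|exact: ex_diff].
    exact.
  have dGg : differentiable (G \o gam) t by exact: differentiable_comp.
  have dj := @differentiable_coord _ 1 n.+1 ((G \o gam) t) 0 j.
  split; first by apply: diff_derivable; exact: (differentiable_comp dGg dj).
  rewrite (derive_comp (1 : R) dGg dj) (derive_comp (1 : R) dgam dG).
  rewrite derive_proj// dg0 ?derive0// /tangent position_proj//.
  exact: tangent_derive_normalize.
have hc : {within `[0, 1], continuous h}.
  apply: derivable_within_continuous => t; rewrite in_itv/= => /h0; case=> //.
have [t|c _] := MVT_segment ler01 _ hc (df := fun=> 0).
  by rewrite in_itv/= => /andP[t0 t1]; apply: h0; rewrite !ltW.
rewrite mul0r => /eqP; rewrite subr_eq0 /h scale0r addr0 scale1r addrC subrK.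
by rewrite !proj_position// => /eqP.
Qed.

(** For [n = 0] and [C > 0] the space form is a pair of antipodal points, and constancy can fail. *)
Lemma dirD0_cst p q : (0 < n)%N -> g p = g q.
Proof.
move=> n0; have [C0|C0] := ltP C 0.
  by apply: dirD0_eq_segment; rewrite addr_gt0// hyperbolic_metric_gt0.
have {}C0 : 0 < C by rewrite lt_neqAle eq_sym C_neq0.
have [qp|qp] := eqVneq (position q) (- position p); last first.
  by apply: dirD0_eq_segment; exact: sphere_metric_gtN1.
(* The segment between antipodal points leaves the cone: use a third point. *)
have [|a ap] := @exists_not_submx _ _ _ (position p).
  by rewrite (leq_ltn_trans (rank_leq_row _)).
have a0 : a != 0 by apply: contraNneq ap => ->; rewrite sub0mx.
have aC : cone C a.
  split; last by rewrite ltNge ltW.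
  rewrite mulr_gt0// lt_neqAle flat_metric_ge0// andbT eq_sym.
  by apply: contra a0 => /eqP/(flat_metric_eq0 C0)/eqP.
have ar : position (proj p a) = normalize C a by rewrite position_proj.
(* Off the line of [p], the third point is antipodal to neither end: [s = -1] excludes this for [p],
   and [s = 1] for [q = - p]. *)
have rp (s : R) : position (proj p a) != s *: position p.
  apply: contra ap => /eqP; rewrite ar /normalize => e.
  rewrite -[a](@scalerK _ _ (Num.sqrt (C * <[a, a]>))^-1).
    by rewrite e; do 2!apply: scalemx_sub.
  by rewrite invr_eq0 gt_eqF// sqrtr_gt0; case: aC.
transitivity (g (proj p a)); apply: dirD0_eq_segment;
  apply: sphere_metric_gtN1 => //.
  by have := rp (-1); rewrite scaleN1r.
rewrite qp; have := rp 1; rewrite scale1r; apply: contra => /eqP/oppr_inj ->.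
by [].
Qed.

End connected.

(** * Concircular fields: from commuting second derivatives to a constant vector *)

Section concircular.
Context {R : realType} {n : nat} {C : R} (C_neq0 : C != 0).
Local Notation E := 'rV[R]_n.+1.
Local Notation M := (space_form n C).
Local Notation "<[ u , v ]>" := (@flat_metric R n C u v).
Context (nabla : (M -> E) -> (M -> E) -> M -> E).
Hypothesis nablaLC : levi_civita nabla.
Context (V : M -> E) (mu : M -> R).
Hypothesis V_field : vector_field V.
Hypothesis V_mu : concircular_factor nabla V mu.
Implicit Types (p q : M) (u v w : E) (X Y : M -> E).

Let sV : smooth V. Proof. by case: V_field. Qed.
Let smu : smooth mu. Proof. by case: V_mu. Qed.

(** The Gauss formula along [tangential v], solved for the derivative of [V]. *)
Lemma dirD_concircular p v : tangent p v ->
  dirD V p v = mu p *: v + (- C * <[v, V p]>) *: position p.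
Proof.
move=> pv; have vv := vector_field_tangential C_neq0 v.
have [_ /(_ _ vv p)] := V_mu; rewrite nablaE// tangential_id// => <-.
by rewrite mulNr scaleNr addrK.
Qed.

(** The derivative of [V] along the field [X] in closed form, ready to be differentiated again. *)
Let G X q : E := mu q *: X q + (- C *: <[X q, V q]>) *: position q.

Let sXV X : vector_field X -> smooth (fun q => <[X q, V q]>).
Proof. by move=> [sX _]; exact: smooth_flat_metric. Qed.

Let sCXV X : vector_field X -> smooth (fun q => - C *: <[X q, V q]>).
Proof.
by move=> /sXV sX; apply: (@smoothZ _ _ _ R) sX; exact: smooth_cst.
Qed.

Let sG X : vector_field X -> smooth (G X).
Proof.
move=> vX; have [sX _] := vX; apply: smoothD; first exact: smoothZ.
by apply: smoothZ; [exact: sCXV|exact: smooth_position].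
Qed.

Let dG X p v : vector_field X -> tangent p v ->
  dirD (G X) p v = mu p *: dirD X p v + dirD mu p v *: X p
    + ((- C * <[X p, V p]>) *: v
       + (- C * (<[X p, dirD V p v]> + <[dirD X p v, V p]>)) *: position p).
Proof.
move=> vX pv; have [sX _] := vX; rewrite /G dirDD//; last 2 first.
- exact: smoothZ.
- by apply: smoothZ; [exact: sCXV|exact: smooth_position].
rewrite dirDZ// dirDZ//; last 2 first.
- exact: sCXV.
- exact: smooth_position.
rewrite dirD_position// (@dirDZ _ _ _ C_neq0 R)//; last 2 first.
- exact: smooth_cst.
- exact: sXV.
by rewrite dirD_cst scale0r addr0 dirD_flat_metric.
Qed.

Lemma concircular_codazzi p u v : tangent p u -> tangent p v ->
  (dirD mu p u + C * <[u, V p]>) *: v = (dirD mu p v + C * <[v, V p]>) *: u.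
Proof.
move=> pu pv; pose X : M -> E := tangential u; pose Y : M -> E := tangential v.
have vX : vector_field X := vector_field_tangential C_neq0 u.
have vY : vector_field Y := vector_field_tangential C_neq0 v.
have dVE Z : vector_field Z -> (fun q => dirD V q (Z q)) = G Z.
  by move=> [_ tZ]; apply/funext => q; rewrite dirD_concircular.
have := @dirD_bracket _ _ _ C_neq0 _ nablaLC V X Y p sV vX vY.
rewrite !dVE// nabla_torsion// => /(_ (sG vX) (sG vY)).
rewrite dirD_concircular; last first.
  by rewrite -(nabla_torsion C_neq0 nablaLC p vX vY) /tangent flat_metricBr
    !(nabla_tangent nablaLC)// subrr.
have Xp : X p = u by exact: tangential_id.
have Yp : Y p = v by exact: tangential_id.
rewrite !dG ?Xp ?Yp// (dirD_concircular pu) (dirD_concircular pv).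
rewrite flat_metricBl !(flat_metricDr, flat_metricZr) (flat_metricC C v u).
rewrite (flat_metricC C v (position p)) (flat_metricC C u (position p)) pu pv.
(* The derivatives [a] and [b] of the two fields cancel between the bracket term and the second
   derivatives, and the terms in [<u, v>] cancel by symmetry. *)
move: (dirD X p v) (dirD Y p u) => a b /rowP e; apply/rowP => j.
move: (e j); rewrite !mxE; lra.
Qed.

Lemma dirD_concircular_factor p v : (2 <= n)%N -> tangent p v ->
  dirD mu p v = - C * <[v, V p]>.
Proof.
move=> n2 pv; apply/eqP; rewrite mulNr -addr_eq0; apply/eqP.
set a := _ + _; apply: contraTeq n2 => a0; rewrite -ltnNge ltnNge.
(* As [n + 1 >= 3], some [w] lies outside the span of [position p] and [v]. If [a] were nonzero, the
   Codazzi identity would make the tangential part of [w] a multiple of [v], putting [w] in that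
   span. *)
apply/negP => n2; have [|w] := @exists_not_submx _ _ _ (position p + v)%MS.
  rewrite ltnS (leq_trans _ n2)// (leq_trans (mxrank_adds_leqif _ _).1)//.
  by rewrite (leq_add (rank_leq_row _) (rank_leq_row _)).
case/negP; have := concircular_codazzi pv (tangent_tangential C_neq0 w p).
rewrite -/a => /(congr1 (GRing.scale a^-1)); rewrite scalerK//.
move=> /(canRL (addrK _)) ->; rewrite -scaleNr addmx_sub//.
- by rewrite !scalemx_sub// addsmxSr.
- by rewrite scalemx_sub// addsmxSl.
Qed.

Lemma concircular_tangential : (2 <= n)%N -> exists u, V = tangential u.
Proof.
(* The constant vector is the value of [V - mu phi] at a chosen point [q]; without points any vector
   will do. *)
move=> n2; have [[q]|noM] := pselect (inhabited M); last first.
  by exists 0; apply/funext => p; case: noM.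
have smmu : smooth (fun q => - 1 *: mu q).
  by apply: (@smoothZ _ _ _ R) smu; exact: smooth_cst.
have smp : smooth (fun q => (- 1 *: mu q) *: position q).
  by apply: smoothZ => //; exact: smooth_position.
pose g q := V q + (- 1 *: mu q) *: position q.
have sg : smooth g by exact: smoothD.
have dg p v : tangent p v -> dirD g p v = 0.
  move=> pv; rewrite /g dirDD// dirDZ//; last exact: smooth_position.
  rewrite (@dirDZ _ _ _ C_neq0 R)//; last exact: smooth_cst.
  rewrite dirD_cst scale0r addr0 dirD_position// dirD_concircular//.
  rewrite dirD_concircular_factor// !scaleN1r !(scaleNr _ v).
  by rewrite !(scaleNr (- C * _)) addrACA !subrr addr0.
exists (g q); apply/is_tangential_partP => // p.
have [_ tV] := V_field; split=> // w pw.
rewrite (dirD0_cst C_neq0 sg dg q p (ltnW n2)) /g addrAC subrr add0r.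
by rewrite flat_metricZl pw mulr0.
Qed.

End concircular.

Theorem theorem1 (R : realType) (n : nat) (C : R)
  (nabla : (space_form n C -> 'rV[R]_n.+1) -> (space_form n C -> 'rV[R]_n.+1) ->
           space_form n C -> 'rV[R]_n.+1)
  (V : space_form n C -> 'rV[R]_n.+1)
  (n_ge2 : (2 <= n)%N) (C_neq0 : C != 0)
  (nablaLC : levi_civita nabla) (V_field : vector_field V) :
  (concircular nabla V <->
     exists p0 : 'rV[R]_n.+1, is_tangential_part p0 V) /\
  (forall (mu : space_form n C -> R) (p0 : 'rV[R]_n.+1),
     concircular_factor nabla V mu -> is_tangential_part p0 V ->
     forall p : space_form n C,
       V p = p0 + mu p *: position p /\
       mu p = - C * flat_metric C p0 (position p)).
Proof.
split; first split.
- move=> [mu Vmu].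
  have [p0 Vp0] := concircular_tangential C_neq0 nablaLC V_field Vmu n_ge2.
  by exists p0; apply/is_tangential_partP.
- move=> [p0 /(is_tangential_partP C_neq0) ->].
  (* The factor is the coefficient found in [nabla_tangential]. *)
  exists (fun q => - C *: flat_metric C p0 (position q)); split.
    apply: (@smoothZ _ _ _ R); first exact: smooth_cst.
    by apply: smooth_flat_metric; [exact: smooth_cst|exact: smooth_position].
  by move=> X vX p; rewrite (nabla_tangential C_neq0 nablaLC).
- move=> mu p0 [_ Vmu] /(is_tangential_partP C_neq0) VE p.
  suff -> : mu p = - C * flat_metric C p0 (position p) by rewrite VE.
  (* Along a field not vanishing at [p], the given factor and the one from [nabla_tangential]
     multiply the same nonzero vector, hence agree. *)
  have [v pv v0] := exists_tangent_neq0 C_neq0 p (ltnW n_ge2).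
  have vv := vector_field_tangential C_neq0 v.
  have := Vmu _ vv p; rewrite VE (nabla_tangential C_neq0 nablaLC)//.
  rewrite tangential_id// => /esym/eqP; rewrite -subr_eq0 -scalerBl scaler_eq0.
  by rewrite (negPf v0) orbF subr_eq0 => /eqP.
Qed.
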